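(* Let $m,n$ be positive integers and let $\mathcal{R}=(r_1,\ldots,r_m)$, $\mathcal{C}=(c_1,\ldots,c_n)$ be sequences of nonnegative integers with $r_1\ge r_2\ge\cdots\ge r_m$ and $c_1\ge c_2\ge\cdots\ge c_n$, and assume that $(\mathcal{R},\mathcal{C})$ is consistent. Let $\alpha=\alpha(\mathcal{R},\mathcal{C})$. Then there exists a set $F_2\subseteq\{1,\ldots,m\}\times\{1,\ldots,n\}$ with row sums $\mathcal{R}$ and column sums $\mathcal{C}$ such that \[ L_h(F_2)\le\min(2r_1+2\alpha,\ 2r_1+2n-2)\quad\text{and}\quad L_v(F_2)\le 2c_1+2\alpha. \]
   Context: For a finite set $F\subseteq\mathbb{Z}^2$, the row sum of row $i$ is $\#\{l:(i,l)\in F\}$ and the column sum of column $j$ is $\#\{k:(k,j)\in F\}$. The pair $(\mathcal{R},\mathcal{C})$ is consistent if there exists $F\subseteq\{1,\ldots,m\}\times\{1,\ldots,n\}$ with row sums $r_1,\ldots,r_m$ and column sums $c_1,\ldots,c_n$. Let $b_i=\#\{j:c_j\ge i\}$ for $i=1,\ldots,m$ and $\alpha(\mathcal{R},\mathcal{C})=\frac12\sum_{i=1}^m|r_i-b_i|$. $L_h(F)$ is the number of ordered pairs $((i,j),(i',j'))$ of points of $\mathbb{Z}^2$ with $|i-i'|=1$, $j=j'$, $(i,j)\in F$, $(i',j')\notin F$; $L_v(F)$ is the number of such pairs with $i=i'$, $|j-j'|=1$, $(i,j)\in F$, $(i',j')\notin F$. *)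

(* Defs.v *)
From HB Require Import structures.
From mathcomp Require Import all_boot all_order all_algebra finmap.
From mathcomp Require Import boolp classical_sets functions cardinality.
Set Implicit Arguments.
Unset Strict Implicit.
Unset Printing Implicit Defensive.
Import Order.TTheory GRing.Theory Num.Theory.
Local Open Scope classical_set_scope.
Local Open Scope ring_scope.

(* A point (i, j) of Z^2 lies in row i and column j. *)
Notation point := (int * int)%type.

(* fset_set sends infinite sets to the empty set; the sets counted below are
   shown to be finite by the finite_* lemmas. *)
Definition ncard (T : choiceType) (A : set T) : nat := #|` fset_set A|.

Definition row_set (F : {fset point}) (i : int) : set int :=
  [set l | (i, l) \in F].
Definition col_set (F : {fset point}) (j : int) : set int :=
  [set k | (k, j) \in F].
Definition row_sum (F : {fset point}) (i : int) : nat := ncard (row_set F i).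
Definition col_sum (F : {fset point}) (j : int) : nat := ncard (col_set F j).

Definition in_box (m n : nat) (F : {fset point}) : Prop :=
  forall p, p \in F -> (1 <= p.1 <= m%:Z) && (1 <= p.2 <= n%:Z).

(* Tuples are indexed from 0: the term r_i of the sequence (r_1, ..., r_m) is
   the component of index i - 1 of r. *)
Definition realizes (m n : nat) (r : m.-tuple nat) (c : n.-tuple nat)
    (F : {fset point}) : Prop :=
  [/\ in_box m n F,
      forall i : 'I_m, row_sum F (i.+1)%:Z = tnth r i
    & forall j : 'I_n, col_sum F (j.+1)%:Z = tnth c j].

Definition consistent (m n : nat) (r : m.-tuple nat) (c : n.-tuple nat) : Prop :=
  exists F : {fset point}, realizes r c F.

Definition conj_seq (n : nat) (c : n.-tuple nat) (i : nat) : nat :=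
  #|[set j : 'I_n | (i <= tnth c j)%N]|%SET.

Definition alpha (m n : nat) (r : m.-tuple nat) (c : n.-tuple nat) : rat :=
  2^-1 * \sum_(i < m) `|(tnth r i)%:R - (conj_seq c i.+1)%:R|.

Definition h_pairs (F : {fset point}) : set (point * point) :=
  [set e | [/\ `|e.1.1 - e.2.1| = 1, e.1.2 = e.2.2, e.1 \in F & e.2 \notin F]].
Definition v_pairs (F : {fset point}) : set (point * point) :=
  [set e | [/\ e.1.1 = e.2.1, `|e.1.2 - e.2.2| = 1, e.1 \in F & e.2 \notin F]].
Definition Lh (F : {fset point}) : nat := ncard (h_pairs F).
Definition Lv (F : {fset point}) : nat := ncard (v_pairs F).

Lemma finite_row_set F i : finite_set (row_set F i).
Proof.
apply: (@sub_finite_set _ _ [set` [fset p.2 | p in F]%fset]) => // l /= Fl.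
by apply/imfsetP; exists (i, l).
Qed.

Lemma finite_col_set F j : finite_set (col_set F j).
Proof.
apply: (@sub_finite_set _ _ [set` [fset p.1 | p in F]%fset]) => // k /= Fk.
by apply/imfsetP; exists (k, j).
Qed.

Lemma dist1P (x y : int) : `|x - y| = 1 -> y = x + 1 \/ y = x - 1.
Proof.
case: (lerP 0 (x - y)) => [xy|xy].
  by rewrite ger0_norm // => h; right; rewrite -h subKr.
by rewrite ltr0_norm // opprB => h; left; rewrite -h addrC subrK.
Qed.

Lemma finite_h_pairs F : finite_set (h_pairs F).
Proof.
pose f s (p : point) : point * point := (p, (p.1 + s, p.2)).
apply: (@sub_finite_set _ _
  [set` ([fset f 1 p | p in F] `|` [fset f (-1) p | p in F])%fset]) => //.
move=> [[i j] [i' j']] [/= /dist1P ii' <- Fp _].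
by rewrite inE; case: ii' => ->; apply/orP; [left|right];
  apply/imfsetP; exists (i, j).
Qed.

Lemma finite_v_pairs F : finite_set (v_pairs F).
Proof.
pose f s (p : point) : point * point := (p, (p.1, p.2 + s)).
apply: (@sub_finite_set _ _
  [set` ([fset f 1 p | p in F] `|` [fset f (-1) p | p in F])%fset]) => //.
move=> [[i j] [i' j']] [/= <- /dist1P jj' Fp _].
by rewrite inE; case: jj' => ->; apply/orP; [left|right];
  apply/imfsetP; exists (i, j).
Qed.

(* Main.v *)
Require Import Defs.
From HB Require Import structures.
From mathcomp Require Import all_boot all_order all_algebra finmap.
From mathcomp Require Import boolp classical_sets functions cardinality.
From mathcomp Require Import zify.
Import Order.TTheory GRing.Theory Num.Theory.
Set Implicit Arguments.
Unset Strict Implicit.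
Unset Printing Implicit Defensive.

(** Half of L_h is r_1 plus the number of cells of F in a row i >= 2 whose
    neighbour in row i - 1 is missing, and similarly for L_v. If W is any Ferrers
    diagram, every such cell either lies in F \ W or its missing neighbour lies
    in W \ F, so the excess is at most |F Delta W| in both directions. It thus
    suffices to find F and W with |F Delta W| <= alpha such that, moreover, each
    column of F starts at most one run below row 1, and some column starts none.

    They are built by induction on the number n of columns, peeling off one
    column. Let s be the number of rows with r_i = n. If c_n = s, the last column
    is {1..s}. Otherwise let t..u be the first maximal block of rows with
    r_i > b_i; its leftmost missing cells are in column v = b_u + 1.
    - If c_n - s <= u - c_v, the last column consists of the rows 1..s and the
      c_n - s last rows of the block, and W has height s there.
    - Otherwise column v consists of the rows 1..u except the u - c_v rows that
      follow row s, and W has height u there.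
    In each case the remaining row sums are monotone and dominated by the
    conjugate of the remaining column sums, and alpha drops by the number of
    cells in which the column differs from W. W remains a Ferrers diagram because
    it is kept between the intersection and the union of the Ferrers diagrams
    of R and of C. *)

(** * Indicator sums and conjugate sequences *)

Lemma sum_interval (a b p : nat) : \sum_(i < p) (a <= i < b : nat) = minn p b - a.
Proof.
elim: p => [|p IHp]; first by rewrite big_ord0; lia.
by rewrite big_ord_recr /= IHp; lia.
Qed.

Lemma sum_ord_bump (n v : nat) (f : nat -> nat) (vn : v <= n) :
  \sum_(j < n.+1) f j = f v + \sum_(j < n) f (bump v j).
Proof.
rewrite (bigD1_ord (inord v)) //= inordK ?ltnS //.
Qed.

Lemma ltn_sum_ord (p k : nat) (f g : nat -> nat) :
  (forall i, i < p -> f i <= g i) -> k < p -> f k < g k ->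
  \sum_(i < p) f i < \sum_(i < p) g i.
Proof.
move=> le_fg lt_kp lt_fg.
rewrite (bigD1 (Ordinal lt_kp)) // [ltnRHS](bigD1 (Ordinal lt_kp)) //=.
by rewrite -addSn leq_add // leq_sum // => i _; apply: le_fg.
Qed.

(** With rows counted from 0 this is b_{i+1}, the conjugate sequence of the first [n] terms of
    [c]. *)
Definition colcount (n : nat) (c : nat -> nat) (i : nat) : nat :=
  \sum_(j < n) (i < c j).

Definition nonincr (f : nat -> nat) : Prop := forall i, f i.+1 <= f i.

Lemma nonincr_leq (f : nat -> nat) : nonincr f -> forall i j, i <= j -> f j <= f i.
Proof.
move=> fmon i j; elim: j => [|j IHj]; first by rewrite leqn0 => /eqP->.
rewrite leq_eqVlt => /orP[/eqP->//|lt_ij].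
by apply: leq_trans (fmon j) _; apply: IHj.
Qed.

(** As [c] is nonincreasing, the columns reaching row [i] form an initial segment, whose length is
    [colcount n c i]. *)
Lemma colcountE (n : nat) (c : nat -> nat) (i j : nat) :
  nonincr c -> j < n -> (j < colcount n c i) = (i < c j).
Proof.
move=> /nonincr_leq cmon lt_jn.
have [lt_ic|le_ci] := ltnP i (c j).
  have := sum_interval 0 j.+1 n => eqI.
  have le: \sum_(k < n) (0 <= k < j.+1 : nat) <= colcount n c i.
    by apply: leq_sum => k _; have := cmon k j; lia.
  lia.
have le: colcount n c i <= \sum_(k < n) (0 <= k < j : nat).
  by apply: leq_sum => k _; have := cmon j k; lia.
have := sum_interval 0 j n; lia.
Qed.

Lemma colcount_nonincr (n : nat) (c : nat -> nat) : nonincr (colcount n c).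
Proof. by move=> i; apply: leq_sum => j _; case: ltnP => //; lia. Qed.

Lemma colcount_bump (n v : nat) (c : nat -> nat) (i : nat) : v <= n ->
  colcount n.+1 c i = (i < c v) + colcount n (fun j => c (bump v j)) i.
Proof. by move=> vn; rewrite /colcount (sum_ord_bump (fun j => (i < c j : nat)) vn). Qed.

(** * Dominance and the invariants of the induction *)

Definition dist (x y : nat) : nat := (x - y) + (y - x).

(** The Gale-Ryser condition, in a form that survives the removal of a column. *)
Record dominated (M n : nat) (r c : nat -> nat) : Prop := Dominated {
  dom_r : nonincr r;
  dom_c : nonincr c;
  dom_rM : forall i, M <= i -> r i = 0;
  dom_cM : forall j, j < n -> c j <= M;
  dom_le : forall p, \sum_(i < p) r i <= \sum_(i < p) colcount n c i;
  dom_eq : \sum_(i < M) r i = \sum_(i < M) colcount n c i }.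

(* Rows and columns are indexed from 0. F j i tells whether the cell in row i and
   column j is filled, and w j is the height of column j of the Ferrers diagram W;
   nf_lo and nf_hi keep W between the Ferrers diagrams of r and of c. *)
Record near_ferrers (M n : nat) (r c : nat -> nat)
    (F : nat -> nat -> bool) (w : nat -> nat) : Prop := NearFerrers {
  nf_c : forall j, j < n -> \sum_(i < M) (F j i : nat) = c j;
  nf_r : forall i, \sum_(j < n) (F j i : nat) = r i;
  nf_w : forall j k, j <= k -> k < n -> w k <= w j;
  nf_lo : forall j i, j < n -> i < c j -> j < r i -> i < w j;
  nf_hi : forall j i, j < n -> i < w j -> (i < c j) || (j < r i);
  nf_diff : 2 * \sum_(j < n) \sum_(i < M) (F j i != (i < w j)) <=
     \sum_(i < M) dist (r i) (colcount n c i);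
  nf_runs : \sum_(j < n) \sum_(i < M) (F j i.+1 && ~~ F j i) <= n.-1 }.

(** * Inserting and removing one column *)

(** Undoes the deletion of index [v], which is written [fun j => f (bump v j)]. *)
Definition insert (T : Type) (v : nat) (x : T) (f : nat -> T) (j : nat) : T :=
  if j == v then x else f (unbump v j).

Lemma insert_id T v (x : T) f : insert v x f v = x.
Proof. by rewrite /insert eqxx. Qed.

Lemma insert_bump T v (x : T) f j : insert v x f (bump v j) = f j.
Proof. by rewrite /insert eq_sym (negbTE (neq_bump _ _)) bumpK. Qed.

Lemma bump_cases (n v j : nat) : v <= n -> j < n.+1 ->
  j = v \/ exists2 k, k < n & j = bump v k.
Proof.
move=> le_vn lt_jn; have [->|ne_jv] := eqVneq j v; first by left.
right; exists (unbump v j); first by rewrite /unbump; lia.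
by rewrite unbumpKcond (negbTE ne_jv).
Qed.

(** Collects what a choice of column [v] has to satisfy for the induction to go through. The column
    may leave the Ferrers column of height [c v] only in rows where this brings r_i and b_i closer,
    and the gain must pay twice for the cells in which it differs from W. *)
Lemma insert_column (M n v : nat) (r c : nat -> nat) (col : nat -> bool) (w0 : nat) F w :
  v <= n ->
  (forall i, col i -> 0 < r i) ->
  \sum_(i < M) (col i : nat) = c v ->
  (forall i, col i -> c v <= i -> colcount n.+1 c i < r i) ->
  (forall i, ~~ col i -> i < c v -> r i < colcount n.+1 c i) ->
  2 * \sum_(i < M) (col i != (i < w0)) <= \sum_(i < M) (col i != (i < c v)) ->
  \sum_(i < M) (col i.+1 && ~~ col i) <= (0 < n) ->
  (forall k, k < n -> if k < v then w0 <= w k else w k <= w0) ->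
  (forall k i, k < n -> i < c (bump v k) -> bump v k < r i -> k < r i - col i) ->
  (forall k i, k < n -> k < r i - col i -> (i < c (bump v k)) || (bump v k < r i)) ->
  (forall i, i < c v -> v < r i -> i < w0) ->
  (forall i, i < w0 -> (i < c v) || (v < r i)) ->
  near_ferrers M n (fun i => r i - col i) (fun j => c (bump v j)) F w ->
  near_ferrers M n.+1 r c (insert v col F) (insert v w0 w).
Proof.
move=> vn col0 colc gt_r lt_r diff runs w_w0 lo' hi' lo0 hi0 [Fc Fr ww lo hi Fdiff Fruns].
split.
- move=> j /(bump_cases vn)[->|[k kn ->]]; first by rewrite insert_id.
  by rewrite insert_bump Fc.
- move=> i; rewrite (sum_ord_bump (fun j => (insert v col F j i : nat)) vn) insert_id.
  under eq_bigr do rewrite insert_bump.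
  rewrite Fr; case: (boolP (col i)) => [/col0|_]; lia.
- move=> j k jk kn.
  have jn : j < n.+1 by lia.
  case: (bump_cases vn jn) jk => [->|[j' j'n ->]];
    case: (bump_cases vn kn) => [->|[k' k'n ->]]; rewrite ?insert_id ?insert_bump // => jk.
  + have := w_w0 _ k'n; case: ltnP => //; move: jk; rewrite /bump; lia.
  + have := w_w0 _ j'n; case: ltnP => //; move: jk; rewrite /bump; lia.
  + apply: ww => //; move: jk; rewrite /bump; lia.
- move=> j i /(bump_cases vn)[->|[k kn ->]]; rewrite ?insert_id ?insert_bump; first exact: lo0.
  by move=> ic ir; apply: lo => //; apply: lo'.
- move=> j i /(bump_cases vn)[->|[k kn ->]]; rewrite ?insert_id ?insert_bump; first exact: hi0.
  by case/(hi _ _ kn)/orP=> [->//|]; apply: hi'.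
- rewrite (sum_ord_bump (fun j => \sum_(i < M) (insert v col F j i != (i < insert v w0 w j))) vn).
  rewrite !insert_id; under [X in _ + X]eq_bigr do rewrite insert_bump insert_bump.
  (* The distance of r_i and b_i drops by exactly one in the rows where [col] and the Ferrers column
     disagree, and is unchanged in the others. *)
  suff -> : \sum_(i < M) dist (r i) (colcount n.+1 c i) =
    \sum_(i < M) (col i != (i < c v)) +
    \sum_(i < M) dist (r i - col i) (colcount n (fun j => c (bump v j)) i).
    by rewrite mulnDr leq_add.
  rewrite -big_split /=; apply: eq_bigr => i _.
  move: (gt_r i) (lt_r i) (col0 i); rewrite (colcount_bump _ _ vn) /dist.
  case: (col i) => /= h1 h2 h3; case: (ltnP i (c v)) => /= h4.
  - by have := h3 isT; lia.
  - by have := h1 isT h4; lia.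
  - by have := h2 isT h4; lia.
  - lia.
- rewrite (sum_ord_bump (fun j => \sum_(i < M) (insert v col F j i.+1 && ~~ insert v col F j i)) vn).
  rewrite insert_id; under [X in _ + X]eq_bigr do rewrite insert_bump.
  (* For [n = 0] the inserted column is the only one and starts no run below the first row; each
     later insertion adds at most one. *)
  move: runs Fruns; case: (n) => [|k] /=; lia.
Qed.

Lemma colcount_le (n : nat) (c : nat -> nat) (i : nat) : colcount n c i <= n.
Proof.
rewrite -[leqRHS]card_ord -sum1_card.
by apply: leq_sum => j _; case: (_ < _).
Qed.

Lemma sum_ltn_bound (p k : nat) : \sum_(i < p) (i < k : nat) = minn p k.
Proof. by have := sum_interval 0 k p; rewrite subn0. Qed.

(** The premise on [col i] and [col i.+1] keeps the row sums monotone where a run of the column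
    ends; the premise on prefixes is dominance after both sides have lost the column. *)
Lemma dominated_remove (M n v : nat) (r c : nat -> nat) (col : nat -> bool) :
  v <= n -> dominated M n.+1 r c ->
  (forall i, col i -> 0 < r i) ->
  \sum_(i < M) (col i : nat) = c v ->
  (forall i, col i -> ~~ col i.+1 -> r i.+1 < r i) ->
  (forall p, \sum_(i < p) r i + minn p (c v) <=
     \sum_(i < p) colcount n.+1 c i + \sum_(i < p) (col i : nat)) ->
  dominated M n (fun i => r i - col i) (fun j => c (bump v j)).
Proof.
move=> vn [rmon cmon rM cM rle req] col0 colc step prefix.
have rsum p : \sum_(i < p) r i = \sum_(i < p) (r i - col i) + \sum_(i < p) (col i : nat).
  rewrite -big_split; apply: eq_bigr => i _ /=.
  by have := col0 i; case: (col i) => //= h; [have := h isT|]; lia.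
have bsum p : \sum_(i < p) colcount n.+1 c i =
    minn p (c v) + \sum_(i < p) colcount n (fun j => c (bump v j)) i.
  rewrite -sum_ltn_bound -big_split; apply: eq_bigr => i _ /=.
  exact: colcount_bump.
split.
- move=> i; have := rmon i; have := step i.
  by case: (col i); case: (col i.+1) => //= h; try have := h isT isT; lia.
- by move=> j; apply: nonincr_leq => //; rewrite /bump; lia.
- by move=> i /rM ->.
- by move=> j jn; apply: cM; rewrite /bump; lia.
- by move=> p; have := prefix p; have := rsum p; have := bsum p; lia.
- have := rsum M; have := bsum M; have := cM v; lia.
Qed.

Lemma first_true_from (f : nat -> bool) (a M : nat) : a <= M -> f M ->
  exists b, [/\ a <= b <= M, f b & forall i, a <= i < b -> ~~ f i].
Proof.
move=> aM fM; have ex : exists b, (a <= b) && f b by exists M; rewrite aM.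
case: (ex_minnP ex) => b /andP[ab fb] min; exists b; split=> //.
  by rewrite ab min // aM.
move=> i /andP[ai ib]; apply/negP => fi; have := min i; rewrite ai fi => /(_ isT); lia.
Qed.

(** If [c n < s], row [c n] has sum n + 1 but misses the last Ferrers column, so the first [s] rows
    violate dominance. *)
Lemma full_rows (M n : nat) (r c : nat -> nat) : dominated M n.+1 r c ->
  exists s, [/\ s <= c n, forall i, i < s -> r i = n.+1 & forall i, s <= i -> r i <= n].
Proof.
case=> rmon cmon rM cM rle req.
have rbound i : r i <= n.+1.
  apply: leq_trans (nonincr_leq rmon (leq0n i)) _.
  have := rle 1; rewrite !big_ord1 => /leq_trans; apply.
  exact: colcount_le.
have [|s [_ rs lts]] := @first_true_from (fun i => r i <= n) 0 M isT.
  by rewrite rM.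
have full i : i < s -> r i = n.+1 by move=> /lts; have := rbound i; lia.
exists s; split=> //; last first.
  by move=> i /(nonincr_leq rmon) /leq_trans; apply.
rewrite leqNgt; apply/negP => lt_cs.
have : \sum_(i < s) colcount n.+1 c i < \sum_(i < s) r i.
  apply: (@ltn_sum_ord _ (c n) (colcount n.+1 c) r) => //.
    by move=> i /full ->; apply: colcount_le.
  rewrite full //.
  by have := colcountE (c n) cmon (ltnSn n); lia.
by have := rle s; lia.
Qed.

(** * Construction of F and W by induction on the number of columns *)

Lemma near_ferrers_exists (M n : nat) (r c : nat -> nat) :
  dominated M n r c -> exists F w, near_ferrers M n r c F w.
Proof.
elim: n r c => [|n IHn] r c dom.
  case: (dom) => rmon cmon rM cM rle req.
  exists (fun _ _ => false), (fun _ => 0); split=> //.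
  - move=> i; rewrite big_ord0.
    have := rle i.+1; rewrite big_ord_recr /= [X in _ <= X]big1 => [|k _].
      by lia.
    by rewrite /colcount big_ord0.
  - by rewrite big_ord0 muln0.
  - by rewrite big_ord0.
have [s [s_le full notfull]] := full_rows dom.
case: (dom) => rmon cmon rM cM rle req.
have rmon' := nonincr_leq rmon; have cmon' := nonincr_leq cmon.
pose b := colcount n.+1 c.
have bE i j : j <= n -> (j < b i) = (i < c j) by move=> jn; apply: colcountE.
have bmon' := nonincr_leq (@colcount_nonincr n.+1 c).
have bn i : i < c n -> n < b i by rewrite bE.
have cnM : c n <= M by apply: cM.
have bump_n k : k < n -> bump n k = k by rewrite /bump; lia.
move: s_le; rewrite leq_eqVlt => /orP[/eqP sE|lt_s].
  have colsum : \sum_(i < M) (i < s : nat) = c n by rewrite sum_ltn_bound; lia.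
  have col0 i : i < s -> 0 < r i by move=> /full->.
  have dom' : dominated M n (fun i => r i - (i < s)) (fun j => c (bump n j)).
    apply: dominated_remove => //.
    - by move=> i i1 i2; rewrite (full i) // ltnS notfull //; lia.
    - by move=> p; rewrite sum_ltn_bound sE leq_add2r rle.
  have [F [w Fw]] := IHn _ _ dom'; exists (insert n (fun i => i < s) F), (insert n s w).
  have lo := nf_lo Fw; have hi := nf_hi Fw.
  apply: insert_column Fw => //.
  - by move=> i; lia.
  - by move=> i; lia.
  - by rewrite big1 // => i _; case: (_ < _).
  - by rewrite big1 // => i _; lia.
  (* Otherwise row [w k] is one of the full rows, so it lies in both remaining Ferrers diagrams in
     column [k], and [nf_lo] puts it into W. *)
  - move=> k kn; rewrite kn leqNgt; apply/negP => wk.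
    suff : w k < w k by rewrite ltnn.
    apply: lo => //; last by rewrite full // wk subn1.
    by rewrite bump_n //; apply: leq_trans (cmon' _ _ (ltnW kn)); lia.
  - move=> k i kn; rewrite bump_n // => _.
    by case: (ltnP i s) => [/full->|_] /=; lia.
  - by move=> k i kn; rewrite bump_n //; lia.
  - by move=> i; lia.
  - by move=> i; lia.
have rb i : i < c n -> r i <= b i.
  by move=> /bn bi; apply: leq_trans bi; have := rmon' s i; have := full i; have := notfull i; lia.
have rb_lt i : s <= i < c n -> r i < b i.
  by case/andP=> /notfull ri /bn; lia.
have [t [/andP[ct tM] rbt before_t]] : exists t,
    [/\ c n <= t <= M, b t < r t & forall i, i < t -> r i <= b i].
  (* The disjunct [i == M] only stops the search. Were it reached, [r] would be at most [b] in all
     rows and smaller in row [s], against the equality of the totals. *)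
  have [|t [tM rt lt_t]] := @first_true_from (fun i => (b i < r i) || (i == M)) (c n) M cnM.
    by rewrite eqxx orbT.
  have le_t i : i < t -> r i <= b i.
    move=> it; case: (ltnP i (c n)) => [/rb //|ci]; have := lt_t i; lia.
  exists t; split=> //; case/orP: rt => // /eqP tE.
  have : \sum_(i < M) r i < \sum_(i < M) b i.
    apply: (@ltn_sum_ord _ s r b) => [i iM||]; [apply: le_t; lia|lia|apply: rb_lt; lia].
  by rewrite req ltnn.
have [u [/andP [tu uM] rbu block]] : exists u,
    [/\ t < u <= M, r u <= b u & forall i, t <= i < u -> b i < r i].
  have tM' : t < M by case: (ltnP t M) => // /rM rt; move: rbt; rewrite rt.
  have [|u [tuM ru lt_u]] := @first_true_from (fun i => r i <= b i) t.+1 M tM'.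
    by rewrite rM.
  exists u; split=> // i; case: (eqVneq i t) => [->|it] //.
  by have := lt_u i; lia.
(* Row [u.-1] is the last one of the block, and [b u.-1] is its first column outside the Ferrers
   diagram of [c]. *)
pose v := b u.-1.
have vr : v < r u.-1 by apply: block; lia.
(* [rv] and [rv'] say that column [v] of the Ferrers diagram of [r] has height exactly [u]. *)
have rv i : i < u -> v < r i by move=> iu; apply: leq_trans vr _; apply: rmon'; lia.
have rv' i : u <= i -> r i <= v.
  by move=> ui; apply: leq_trans (rmon' _ _ ui) _; apply: leq_trans rbu _; apply: bmon'; lia.
have vn : v < n.
  have : r u.-1 <= n by apply: notfull; lia.
  lia.
have cvu : c v < u by have := bE u.-1 v (ltnW vn); lia.
have tcv : t <= c v.
  case: (posnP t) => [->//|t0]; have := bE t.-1 v (ltnW vn).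
  have := before_t t.-1; have := rv t.-1; lia.
have [R RE] : exists R, forall p, \sum_(i < p) r i = R p by exists (fun p => \sum_(i < p) r i).
have [B BE] : exists B, forall p, \sum_(i < p) b i = B p by exists (fun p => \sum_(i < p) b i).
have rle' p : R p <= B p by rewrite -RE -BE.
have RS p : R p.+1 = R p + r p by rewrite -!RE big_ord_recr.
have BS p : B p.+1 = B p + b p by rewrite -!BE big_ord_recr.
(* Dominance has enough slack up to row u: it grows over the rows before t and
   falls to a nonnegative value over the block. *)
have slack1 p : p <= t -> R p + (minn p (c n) - s) <= B p.
  move=> pt; rewrite -RE -BE -(sum_interval s (c n)) -big_split; apply: leq_sum => i _ /=.
  have it : i < t by apply: leq_trans pt.
  by have := before_t i it; have := rb_lt i; lia.
have slack2 p : t <= p -> p <= u -> R p + (u - p) <= B p.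
  move=> tp pu.
  have drop d : p + d <= u -> R p + d + B (p + d) <= R (p + d) + B p.
    elim: d => [|d IHd] du; first by rewrite !addn0.
    have bd : b (p + d) < r (p + d) by apply: block; lia.
    have : p + d <= u by lia.
    by move=> /IHd; rewrite (addnS p) RS BS; clear - bd; lia.
  have := drop (u - p); rewrite subnKC // => /(_ (leqnn u)); have := rle' u.
  lia.
have [le_E|lt_D] := leqP (c n - s) (u - c v).
(* By [le_E] the lower part starts at or below row [c v], hence inside the block and outside the
   Ferrers column of height [c n]. *)
- pose col i := (i < s) || (u - (c n - s) <= i < u).
  have colE p : \sum_(i < p) (col i : nat) = minn p s + (minn p u - (u - (c n - s))).
    rewrite -sum_ltn_bound -sum_interval -big_split; apply: eq_bigr => i _ /=.
    by rewrite /col; lia.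
  have col0 i : col i -> 0 < r i.
    by case/orP=> [/full->//|h]; have := rv i; lia.
  have colsum : \sum_(i < M) (col i : nat) = c n by rewrite colE; lia.
  have dom' : dominated M n (fun i => r i - col i) (fun j => c (bump n j)).
    apply: dominated_remove => //.
    (* Runs of the column end only just before [s] and [u], where [r] drops strictly. *)
    - move=> i; rewrite /col => i1 i2; have [iu|iu] : i.+1 = s \/ i.+1 = u by lia.
        by rewrite (full i) ?ltnS ?notfull; lia.
      by have := rv i; have := rv' i.+1; lia.
    (* A prefix ending inside the block still lacks at most [u - p] of the lower cells, which
       [slack2] covers. *)
    - move=> p; rewrite colE RE BE.
      have [pt|tp] := leqP p t.
        by have := slack1 p pt; clear - le_E lt_s ct tu pt; lia.
      have [pu|up] := leqP p u.
        by have := slack2 p (ltnW tp) pu; clear - le_E lt_s ct tu tp pu; lia.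
      by have := rle' p; clear - le_E lt_s ct tu tp up; lia.
  have [F [w Fw]] := IHn _ _ dom'; exists (insert n col F), (insert n s w).
  have lo := nf_lo Fw; have hi := nf_hi Fw.
  apply: insert_column Fw => //.
  - move=> i; rewrite /col => i1 i2; apply: block; lia.
  - move=> i; rewrite /col => i1 i2; apply: rb_lt; lia.
  (* The [c n - s] lower cells are the whole difference from W; the difference from the Ferrers
     column also counts as many vacated rows. *)
  - have -> : \sum_(i < M) (col i != (i < s)) = minn M u - (u - (c n - s)).
      rewrite -sum_interval; apply: eq_bigr => i _; rewrite /col.
      by clear - lt_s ct tcv le_E cvu; lia.
    have -> : \sum_(i < M) (col i != (i < c n)) =
        (minn M (c n) - s) + (minn M u - (u - (c n - s))).
      rewrite -!sum_interval -big_split; apply: eq_bigr => i _ /=; rewrite /col.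
      by clear - lt_s ct tcv le_E cvu; lia.
    by clear - lt_s cnM uM; lia.
  - have -> : 0 < n by apply: leq_trans vn.
    (* Row [a] is the only place below the first row where a run can start; the sum counts it at
       index [a.-1]. *)
    pose a := u - (c n - s).
    have /leq_trans : \sum_(i < M) (col i.+1 && ~~ col i) <= \sum_(i < M) (a.-1 <= i < a : nat).
      apply: leq_sum => i _; rewrite /col /a; clear - lt_s ct tcv le_E cvu; lia.
    by apply; rewrite sum_interval; lia.
  - move=> k kn; rewrite kn leqNgt; apply/negP => wk.
    suff : w k < w k by rewrite ltnn.
    apply: lo => //; last by rewrite full // /col wk subn1.
    by rewrite bump_n //; apply: leq_trans (cmon' _ _ (ltnW kn)); lia.
  - move=> k i kn; rewrite bump_n // -(bE _ _ (ltnW kn)) => kb kr.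
    case: (ltnP i s) => [si|si]; first by rewrite full // /col si; clear - kn; lia.
    have : u - (c n - s) <= i < u -> b i < r i.
      by move=> h; apply: block; clear - h le_E cvu tcv; lia.
    rewrite /col (ltnNge i s) si /=; case: (_ <= _ < _) => [/(_ isT)|_] /=; clear - kb kr; lia.
  - by move=> k i kn; rewrite bump_n //; lia.
  - by move=> i _ ri; have := notfull i; lia.
  - by move=> i; lia.
(* By [lt_D] the omitted rows end before [c n], so they satisfy [r i < b i]; the cells gained are
   the rows from [c v] to [u.-1] of the block. *)
- pose col i := (i < s) || (s + (u - c v) <= i < u).
  have colE p : \sum_(i < p) (col i : nat) = minn p s + (minn p u - (s + (u - c v))).
    rewrite -sum_ltn_bound -sum_interval -big_split; apply: eq_bigr => i _ /=.
    by rewrite /col; lia.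
  have col0 i : col i -> 0 < r i.
    by move=> ci; have := rv i; move: ci; rewrite /col; lia.
  have colsum : \sum_(i < M) (col i : nat) = c v by rewrite colE; lia.
  have dom' : dominated M n (fun i => r i - col i) (fun j => c (bump v j)).
    apply: dominated_remove => //; first by lia.
    - move=> i; rewrite /col => i1 i2; have [iu|iu] : i.+1 = s \/ i.+1 = u by lia.
        by rewrite (full i) ?ltnS ?notfull; lia.
      by have := rv i; have := rv' i.+1; lia.
    - move=> p; rewrite colE RE BE.
      have [pt|tp] := leqP p t.
        by have := slack1 p pt; clear - lt_D lt_s ct tu pt cvu tcv; lia.
      have [pu|up] := leqP p u.
        by have := slack2 p (ltnW tp) pu; clear - lt_D lt_s ct tu tp pu cvu tcv; lia.
      by have := rle' p; clear - lt_D lt_s ct tu tp up cvu tcv; lia.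
  have [F [w Fw]] := IHn _ _ dom'; exists (insert v col F), (insert v u w).
  have cle k : v <= k -> k <= n -> c n <= c k <= c v.
    by move=> vk kn; rewrite !cmon'.
  have lo := nf_lo Fw; have hi := nf_hi Fw.
  apply: insert_column Fw => //; first by lia.
  - move=> i; rewrite /col => i1 i2; apply: block; lia.
  - move=> i; rewrite /col => i1 i2; apply: rb_lt; lia.
  - have -> : \sum_(i < M) (col i != (i < u)) = minn M (s + (u - c v)) - s.
      rewrite -sum_interval; apply: eq_bigr => i _; rewrite /col.
      by clear - lt_s ct tcv lt_D cvu; lia.
    have -> : \sum_(i < M) (col i != (i < c v)) =
        (minn M (s + (u - c v)) - s) + (minn M u - c v).
      rewrite -!sum_interval -big_split; apply: eq_bigr => i _ /=; rewrite /col.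
      by clear - lt_s ct tcv lt_D cvu; lia.
    by clear - lt_D lt_s cnM uM; lia.
  - have -> : 0 < n by apply: leq_trans vn.
    pose a := s + (u - c v).
    have /leq_trans : \sum_(i < M) (col i.+1 && ~~ col i) <= \sum_(i < M) (a.-1 <= i < a : nat).
      apply: leq_sum => i _; rewrite /col /a; clear - lt_s ct tcv lt_D cvu; lia.
    by apply; rewrite sum_interval; lia.
  (* Left of [v], a row [w k < u] would lie in both remaining Ferrers diagrams, so [nf_lo] puts it
     into W. From [v] on, row [u] lies in neither, so [nf_hi] keeps it out. *)
  - move=> k kn; case: (ltnP k v) => [kv|vk]; rewrite leqNgt; apply/negP => wk.
      suff : w k < w k by rewrite ltnn.
      apply: lo => //.
        have -> : bump v k = k by rewrite /bump; lia.
        have vb : v <= b (w k) by apply: bmon'; lia.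
        by rewrite -bE; [apply: leq_trans vb|lia].
      by have := rv _ wk; case: (col _) => /=; lia.
    have := hi _ _ kn wk; have := rv' u (leqnn u).
    have := cle (bump v k); rewrite /bump; lia.
  - move=> k i kn; case: (ltnP k v) => [kv|vk] _; last by rewrite /bump; lia.
    have -> : bump v k = k by rewrite /bump; lia.
    case: (ltnP i u) => [/rv|ui]; first by clear - kv; lia.
    by rewrite /col; clear - ui lt_s lt_D ct tu; lia.
  - move=> k i kn; case: (ltnP k v) => [kv|vk]; first by rewrite /bump; lia.
    (* Here [i < u]. If row [i] is omitted from the column, then [i < c n], and every column of the
       Ferrers diagram of [c] contains it. *)
    have := cle (bump v k); have := rv' i.
    by rewrite /bump /col; lia.
  - by move=> i; lia.
  - by move=> i /rv ->; rewrite orbT.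
Qed.

(** * Runs of cells, and necessity of dominance *)

(** A run start at [i.+1] is charged to that cell if it lies outside [g], and otherwise to the
    missing cell [i], which then lies in [g]. No cell is charged twice. *)
Lemma run_starts_le_diff (k : nat) (f g : nat -> bool) :
  (forall i, g i.+1 -> g i) -> f k = false ->
  \sum_(i < k) (f i.+1 && ~~ f i) <= \sum_(i < k) (f i != g i).
Proof.
move=> gmon fk.
(* The last boundary term holds a charge to cell [k], which the sum does not reach yet. *)
suff : \sum_(i < k) (f i.+1 && ~~ f i) + (f 0 && ~~ g 0) <=
    \sum_(i < k) (f i != g i) + (f k && ~~ g k) by rewrite fk; lia.
elim: {fk} k => [|k IHk]; first by rewrite !big_ord0.
rewrite !big_ord_recr /=; move: IHk (gmon k).
case: (f k.+1); case: (f k); case: (g k); case: (g k.+1) => //=; try lia.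
all: by move=> _ /(_ isT).
Qed.

Lemma run_ends (k : nat) (f : nat -> bool) : f k = false ->
  \sum_(i < k) (f i && ~~ f i.+1) = f 0 + \sum_(i < k) (f i.+1 && ~~ f i).
Proof.
move=> fk.
suff : \sum_(i < k) (f i && ~~ f i.+1) + f k = f 0 + \sum_(i < k) (f i.+1 && ~~ f i).
  by rewrite fk addn0.
elim: {fk} k => [|k IHk]; first by rewrite !big_ord0 addn0.
rewrite !big_ord_recr /=; move: IHk; case: (f k.+1); case: (f k) => /=; lia.
Qed.

Lemma run_starts (k : nat) (f : nat -> bool) : f k = false ->
  \sum_(i < k) (f i && ((i == 0 :> nat) || ~~ f i.-1)) =
  f 0 + \sum_(i < k) (f i.+1 && ~~ f i).
Proof.
case: k => [|k] fk; first by rewrite !big_ord0 fk.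
by rewrite big_ord_recl big_ord_recr /= fk addn0 andbT.
Qed.

(** The easy half of Gale-Ryser: the first [p] rows contain at most min(p, c_j) cells of column
    j. *)
Lemma dominated_of_matrix (M n : nat) (r c : nat -> nat) (g : nat -> nat -> bool) :
  nonincr r -> nonincr c -> (forall i j, g i j -> i < M) ->
  (forall i, \sum_(j < n) (g i j : nat) = r i) ->
  (forall j, j < n -> \sum_(i < M) (g i j : nat) = c j) ->
  dominated M n r c.
Proof.
move=> rmon cmon gM gr gc.
have exch p : \sum_(i < p) colcount n c i = \sum_(j < n) minn p (c j).
  rewrite exchange_big; apply: eq_bigr => j _; exact: sum_ltn_bound.
have rexch p : \sum_(i < p) r i = \sum_(j < n) \sum_(i < p) (g i j : nat).
  by rewrite exchange_big; apply: eq_bigr => i _; rewrite gr.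
have cM j : j < n -> c j <= M.
  move=> jn; rewrite -gc // -[leqRHS]card_ord -sum1_card.
  by apply: leq_sum => i _; case: (g _ _).
split=> //.
- move=> i Mi; rewrite -gr big1 // => j _; case gij: (g i j) => //.
  by have := gM _ _ gij; lia.
- move=> p; rewrite exch rexch; apply: leq_sum => j _; rewrite leq_min; apply/andP; split.
    by rewrite -[leqRHS]card_ord -sum1_card; apply: leq_sum => i _; case: (g _ _).
  rewrite -gc //; case: (leqP p M) => [pM|Mp].
    by rewrite -(subnKC pM) big_split_ord leq_addr.
  rewrite -(subnKC (ltnW Mp)) big_split_ord /= [X in _ + X]big1 ?addn0 // => i _.
  by case gij: (g _ _) => //; have := gM _ _ gij; lia.
- rewrite exch rexch; apply: eq_bigr => j _; rewrite gc //.
  by have := cM _ (ltn_ord j); lia.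
Qed.

(** * Cardinalities of finite sets as sums of indicators *)

Lemma ncard_le_seq (T : choiceType) (A : set T) (s : seq T) :
  (forall x, A x -> x \in s) -> ncard A <= size s.
Proof.
move=> As; have finA : finite_set A by apply: (@sub_finite_set _ _ [set` s]%classic).
apply: leq_trans (size_undup s); rewrite -card_fseq.
apply: fsubset_leq_card; apply/fsubsetP => x; rewrite in_fset_set // inE => /As.
by rewrite in_fset.
Qed.

Lemma ncard_seq (T : choiceType) (A : set T) (s : seq T) :
  (forall x, A x <-> x \in s) -> uniq s -> ncard A = size s.
Proof.
move=> As us; have finA : finite_set A.
  by apply: (@sub_finite_set _ _ [set` s]%classic) => // x /As.
rewrite -[in RHS](undup_id us) -card_fseq; congr (#|` _|); apply/fsetP => x.
rewrite in_fset_set // in_fset; apply/idP/idP; first by rewrite inE => /As.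
by move=> /As; rewrite inE.
Qed.

(** The two families stand for the pairs of a cell with its next and with its previous neighbour. *)
Lemma ncard_le_sum (T : choiceType) (A : set T) (m n : nat)
    (P : nat -> nat -> bool) (f : nat -> nat -> T) (Q : nat -> nat -> bool) (h : nat -> nat -> T) :
  (forall x, A x -> exists i j, [/\ i < m, j < n & P i j /\ x = f i j \/ Q i j /\ x = h i j]) ->
  ncard A <= \sum_(i < m) \sum_(j < n) (P i j : nat) + \sum_(i < m) \sum_(j < n) (Q i j : nat).
Proof.
move=> AE; pose s (P : nat -> nat -> bool) (f : nat -> nat -> T) :=
  [seq f p.1 p.2 | p : 'I_m * 'I_n <- enum [pred p : 'I_m * 'I_n | P p.1 p.2]].
have sE R k : size (s R k) = \sum_(i < m) \sum_(j < n) (R i j : nat).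
  by rewrite size_map -cardE -sum1_card pair_bigA /= big_mkcond.
rewrite -(sE P f) -(sE Q h) -size_cat; apply: ncard_le_seq => x /AE[i [j [im jn]]].
rewrite mem_cat; case=> -[Pij ->]; apply/orP; [left|right]; apply/mapP;
  by exists (Ordinal im, Ordinal jn); rewrite ?mem_enum.
Qed.

Lemma ncard_interval (A : set int) (n : nat) (g : nat -> bool) :
  (forall x, A x <-> exists2 j, j < n & g j /\ x = Posz j.+1) ->
  ncard A = \sum_(j < n) (g j : nat).
Proof.
move=> AE; rewrite (@ncard_seq _ _ [seq Posz j.+1 | j : 'I_n <- enum [pred j : 'I_n | g j]]).
- by rewrite size_map -cardE -sum1_card big_mkcond.
- move=> x; rewrite AE; split=> [[j jn [gj ->]]|/mapP[j]].
    by apply/mapP; exists (Ordinal jn); rewrite ?mem_enum.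
  by rewrite mem_enum => gj ->; exists j.
- by rewrite map_inj_uniq ?enum_uniq // => i j [] /val_inj.
Qed.

(** * Sets in the box as boolean matrices *)

(** Indices are shifted to start at 0, and the row comes first, unlike in [F j i]. *)
Record grid (m n : nat) (S : {fset int * int}) (g : nat -> nat -> bool) : Prop := Grid {
  grid_mem : forall i j, ((Posz i.+1, Posz j.+1) \in S) = g i j;
  grid_box : forall p, p \in S -> exists i j, [/\ i < m, j < n & p = (Posz i.+1, Posz j.+1)] }.

Lemma in_box_grid (m n : nat) (S : {fset int * int}) : in_box m n S ->
  grid m n S (fun i j => (Posz i.+1, Posz j.+1) \in S).
Proof.
move=> box; split=> // -[x y] /[dup] Sp /box /= /andP[xm yn].
case: x xm Sp => [[|i]|i] // xm; case: y yn => [[|j]|j] // yn Sp.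
by exists i, j; split=> //; lia.
Qed.

Lemma grid_lt (m n : nat) (S : {fset int * int}) (g : nat -> nat -> bool)
    (Sg : grid m n S g) i j :
  g i j -> i < m /\ j < n.
Proof.
by rewrite -(grid_mem Sg) => /(grid_box Sg)[i' [j' [im jn [-> ->]]]].
Qed.

Lemma grid_in_box (m n : nat) (S : {fset int * int}) (g : nat -> nat -> bool)
    (Sg : grid m n S g) :
  in_box m n S.
Proof. by move=> p /(grid_box Sg)[i [j [im jn ->]]] /=; lia. Qed.

Lemma row_sum_grid (m n : nat) (S : {fset int * int}) (g : nat -> nat -> bool)
    (Sg : grid m n S g) i :
  row_sum S (Posz i.+1) = \sum_(j < n) (g i j : nat).
Proof.
apply: (@ncard_interval _ n (g i)) => x; rewrite /row_set /=; split.
  move=> /[dup] Sx /(grid_box Sg)[i' [j [_ jn [ii' xj]]]]; exists j => //.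
  by split=> //; rewrite -(grid_mem Sg) -xj.
by case=> j jn [gij ->]; rewrite (grid_mem Sg).
Qed.

Lemma col_sum_grid (m n : nat) (S : {fset int * int}) (g : nat -> nat -> bool)
    (Sg : grid m n S g) j :
  col_sum S (Posz j.+1) = \sum_(i < m) (g i j : nat).
Proof.
apply: (@ncard_interval _ m (g^~ j)) => x; rewrite /col_set /=; split.
  move=> /[dup] Sx /(grid_box Sg)[i [j' [im _ [xi jj']]]]; exists i => //.
  by split=> //; rewrite -(grid_mem Sg) -xi.
by case=> i im [gij ->]; rewrite (grid_mem Sg).
Qed.

(** Boundary pairs sit at the two ends of the runs in each column, and a run starts either in the
    first row or below a missing cell. *)
Lemma Lh_grid (m n : nat) (S : {fset int * int}) (g : nat -> nat -> bool)
    (Sg : grid m n S g) :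
  Lh S <= 2 * (\sum_(j < n) (g 0 j : nat) +
  \sum_(j < n) \sum_(i < m) (g i.+1 j && ~~ g i j)).
Proof.
have gm j : g m j = false.
  by apply/negP => /(grid_lt Sg)[]; rewrite ltnn.
pose P i j := g i j && ~~ g i.+1 j.
(* As [0.-1 = 0], the first row is treated apart: its upper neighbour lies outside the box. *)
pose Q i j := g i j && ((i == 0 :> nat) || ~~ g i.-1 j).
have := @ncard_le_sum _ (h_pairs S) m n
  P (fun i j => ((Posz i.+1, Posz j.+1), (Posz i.+2, Posz j.+1)))
  Q (fun i j => ((Posz i.+1, Posz j.+1), (Posz i, Posz j.+1))).
rewrite exchange_big [X in _ + X]exchange_big /=.
under eq_bigr do rewrite (@run_ends m (fun i => g i _)) //.
under [X in _ + X]eq_bigr do rewrite (@run_starts m (fun i => g i _)) //.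
rewrite big_split /= addnn -mul2n; apply.
move=> [[x y] [x' y']] [/= d <- /[dup] Sp /(grid_box Sg)[i [j [im jn [xE yE]]]]].
move=> nS; exists i, j; split=> //; move: d nS Sp; rewrite {}xE {}yE => /dist1P.
case=> -> nS Sp; [left|right].
  have e : (Posz i.+1 + 1)%R = Posz i.+2 by lia.
  by rewrite e in nS *; rewrite /P -!(grid_mem Sg) nS Sp.
have e : (Posz i.+1 - 1)%R = Posz i by lia.
rewrite e in nS *; rewrite /Q -(grid_mem Sg) Sp; split=> //; move: nS {e Sp}.
by case: i {im} => //= i; rewrite -(grid_mem Sg) => ->.
Qed.

Lemma Lv_grid (m n : nat) (S : {fset int * int}) (g : nat -> nat -> bool)
    (Sg : grid m n S g) :
  Lv S <= 2 * (\sum_(i < m) (g i 0 : nat) +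
  \sum_(i < m) \sum_(j < n) (g i j.+1 && ~~ g i j)).
Proof.
have gn i : g i n = false.
  by apply/negP => /(grid_lt Sg)[]; rewrite ltnn.
pose P i j := g i j && ~~ g i j.+1.
pose Q i j := g i j && ((j == 0 :> nat) || ~~ g i j.-1).
have := @ncard_le_sum _ (v_pairs S) m n
  P (fun i j => ((Posz i.+1, Posz j.+1), (Posz i.+1, Posz j.+2)))
  Q (fun i j => ((Posz i.+1, Posz j.+1), (Posz i.+1, Posz j))).
under eq_bigr do rewrite (@run_ends n (g _)) //.
under [X in _ + X]eq_bigr do rewrite (@run_starts n (g _)) //.
rewrite big_split /= addnn -mul2n; apply.
move=> [[x y] [x' y']] [/= <- d /[dup] Sp /(grid_box Sg)[i [j [im jn [xE yE]]]]].
move=> nS; exists i, j; split=> //; move: d nS Sp; rewrite {}xE {}yE => /dist1P.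
case=> -> nS Sp; [left|right].
  have e : (Posz j.+1 + 1)%R = Posz j.+2 by lia.
  by rewrite e in nS *; rewrite /P -!(grid_mem Sg) nS Sp.
have e : (Posz j.+1 - 1)%R = Posz j by lia.
rewrite e in nS *; rewrite /Q -(grid_mem Sg) Sp; split=> //; move: nS {e Sp}.
by case: j {jn} => //= j; rewrite -(grid_mem Sg) => ->.
Qed.

Lemma grid_exists (m n : nat) (g : nat -> nat -> bool) :
  (forall i j, g i j -> i < m /\ j < n) -> exists S, grid m n S g.
Proof.
move=> gmn.
pose s := [seq (Posz p.1.+1, Posz p.2.+1) | p : 'I_m * 'I_n <-
  enum [pred p : 'I_m * 'I_n | g p.1 p.2]].
exists [fset x in s]%fset; split.
  move=> i j; rewrite in_fset; apply/mapP/idP.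
    by case=> p; rewrite mem_enum => gp [-> ->].
  by move=> gij; have [im jn] := gmn _ _ gij; exists (Ordinal im, Ordinal jn); rewrite ?mem_enum.
by move=> p; rewrite in_fset => /mapP[[i j] _ ->]; exists i, j.
Qed.

Lemma nonincr_nth (s : seq nat) : sorted geq s -> nonincr (nth 0 s).
Proof.
move=> ss i; case: (ltnP i.+1 (size s)) => [si|/(nth_default 0)->//].
by apply: (sortedP 0 ss).
Qed.

(** * The bounds on L_h and L_v *)

Lemma near_ferrers_grid (m n : nat) (r c : nat -> nat) F w :
  0 < n -> (forall i, m <= i -> r i = 0) -> near_ferrers m n r c F w ->
  exists S, [/\ in_box m n S,
    forall i, row_sum S (Posz i.+1) = r i,
    forall j, j < n -> col_sum S (Posz j.+1) = c j,
    Lh S <= 2 * (r 0 + n.-1) /\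
    Lh S <= 2 * r 0 + \sum_(i < m) dist (r i) (colcount n c i)
    & Lv S <= 2 * c 0 + \sum_(i < m) dist (r i) (colcount n c i)].
Proof.
(* The cut to the box matters because [F j i] is arbitrary for [n <= j]. *)
move=> n0 rm Fw; pose g i j := [&& i < m, j < n & F j i].
have gE i j : i < m -> j < n -> g i j = F j i by rewrite /g => -> ->.
have g_lt i j : g i j -> i < m /\ j < n by case/and3P.
have gr i : \sum_(j < n) (g i j : nat) = r i.
  case: (ltnP i m) => [im|mi]; last first.
    by rewrite rm // big1 // => j _; rewrite /g ltnNge mi.
  by rewrite -(nf_r Fw); apply: eq_bigr => j _; rewrite gE.
have gc j : j < n -> \sum_(i < m) (g i j : nat) = c j.
  by move=> jn; rewrite -(nf_c Fw) //; apply: eq_bigr => i _; rewrite gE.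
have [S Sg] := grid_exists g_lt.
pose d := \sum_(j < n) \sum_(i < m) (F j i != (i < w j)).
have dA : 2 * d <= \sum_(i < m) dist (r i) (colcount n c i) := nf_diff Fw.
have hd : \sum_(j < n) \sum_(i < m) (g i.+1 j && ~~ g i j) <= d.
  apply: leq_sum => j _.
  apply: (@leq_trans (\sum_(i < m) (g i j != (i < w j)))); last first.
    by apply: eq_leq; apply: eq_bigr => i _; rewrite gE.
  apply: (@run_starts_le_diff m (g^~ j) (fun i => i < w j)) => [i|]; first exact: ltnW.
  by rewrite /g ltnn.
have hn : \sum_(j < n) \sum_(i < m) (g i.+1 j && ~~ g i j) <= n.-1.
  apply: leq_trans (nf_runs Fw); apply: leq_sum => j _; apply: leq_sum => i _.
  by rewrite (gE i) // /g; case: (i.+1 < m) => //=; rewrite ltn_ord.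
have vd : \sum_(i < m) \sum_(j < n) (g i j.+1 && ~~ g i j) <= d.
  rewrite /d [leqRHS]exchange_big; apply: leq_sum => i _.
  (* By [nf_w] the rows of W are initial segments too, so the same charging works along rows; [w] is
     monotone only below [n], whence the conjunct [j < n]. *)
  apply: (@leq_trans (\sum_(j < n) (g i j != (j < n) && (i < w j)))); last first.
    by apply: eq_leq; apply: eq_bigr => j _; rewrite gE // ltn_ord.
  apply: (@run_starts_le_diff n (g i) (fun j => (j < n) && (i < w j))) => [j|].
    case/andP=> jn iw; rewrite ltnW //=; apply: leq_trans iw _.
    exact: (nf_w Fw).
  by rewrite /g ltnn andbF.
exists S; split.
- exact: grid_in_box Sg.
- by move=> i; rewrite (row_sum_grid Sg) gr.
- by move=> j jn; rewrite (col_sum_grid Sg) gc.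
- by have := Lh_grid Sg; rewrite gr; split; lia.
- by have := Lv_grid Sg; rewrite gc //; lia.
Qed.

Lemma dominated_of_consistent (m n : nat) (r : m.-tuple nat) (c : n.-tuple nat) :
  sorted geq r -> sorted geq c -> consistent r c ->
  dominated m n (nth 0 r) (nth 0 c).
Proof.
move=> hr hc [S [/in_box_grid Sg Sr Sc]].
apply: (@dominated_of_matrix m n _ _ (fun i j => (Posz i.+1, Posz j.+1) \in S));
  try exact: nonincr_nth.
- by move=> i j /(grid_lt Sg)[].
- move=> i; rewrite -(row_sum_grid Sg); case: (ltnP i m) => [im|mi].
    by rewrite (Sr (Ordinal im)) (tnth_nth 0).
  rewrite (row_sum_grid Sg) big1 ?nth_default ?size_tuple // => j _.
  by case Sij: (_ \in _) => //; have [] := grid_lt Sg Sij; lia.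
- by move=> j jn; rewrite -(col_sum_grid Sg) (Sc (Ordinal jn)) (tnth_nth 0).
Qed.

Lemma alphaE (m n : nat) (r : m.-tuple nat) (c : n.-tuple nat) :
  (2 * alpha r c = (\sum_(i < m) dist (nth 0%N r i) (colcount n (nth 0%N c) i))%:R)%R.
Proof.
rewrite /alpha mulrA divff // mul1r natr_sum; apply: eq_bigr => i _.
have -> : conj_seq c i.+1 = colcount n (nth 0%N c) i.
  rewrite /conj_seq /colcount -sum1dep_card big_mkcond; apply: eq_bigr => j _.
  by rewrite (tnth_nth 0); case: (_ < _).
rewrite (tnth_nth 0) /dist; set x := nth _ _ _; set y := colcount _ _ _.
case: (leqP x y) => [xy|/ltnW yx].
  have -> : (x - y + (y - x) = y - x)%N by lia.
  by rewrite distrC natrB // ger0_norm // subr_ge0 ler_nat.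
have -> : (x - y + (y - x) = x - y)%N by lia.
by rewrite natrB // ger0_norm // subr_ge0 ler_nat.
Qed.

Local Open Scope ring_scope.

Theorem theorem4 (m n : nat) (r : m.-tuple nat) (c : n.-tuple nat)
    (hm : (0 < m)%N) (hn : (0 < n)%N)
    (hr : sorted geq r) (hc : sorted geq c) (hrc : consistent r c) :
  exists F2 : {fset int * int},
    [/\ realizes r c F2,
        (Lh F2)%:R <= Num.min (2 * (head 0%N r)%:R + 2 * alpha r c)
                              (2 * (head 0%N r)%:R + 2 * n%:R - 2)
      & (Lv F2)%:R <= 2 * (head 0%N c)%:R + 2 * alpha r c].
Proof.
have dom := dominated_of_consistent hr hc hrc.
have [F [w Fw]] := near_ferrers_exists dom.
have [S [box Sr Sc [Lh1 Lh2] Lv1]] := near_ferrers_grid hn (dom_rM dom) Fw.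
exists S; split.
- split=> //; first by move=> i; rewrite Sr (tnth_nth 0%N).
  by move=> j; rewrite Sc // (tnth_nth 0%N).
- rewrite le_min alphaE -nth0 -!natrM -!natrD ler_nat Lh2 /=.
  (* Truncated subtraction agrees with the rational one because [n] is positive. *)
  rewrite -natrB ?ler_nat; last by lia.
  by lia.
- by rewrite alphaE -nth0 -natrM -natrD ler_nat.
Qed.
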